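(* Let $t=t(n)$ be a positive integer with $t\big/\sqrt[3]{n/\log^2 n}\to 0$ as $n\to\infty$. Then the number of $t$ error correcting codes in $\mathcal P(n)$ is at most $2^{H(n,t)(1+o(1))}$, where $o(1)\to0$ as $n\to\infty$.
   Context: Subsets of $[n]$ are identified with $0/1$ strings of length $n$. The Hamming distance is $d(A,B)=|A\setminus B|+|B\setminus A|$. A family $\mathcal C\subseteq\mathcal P(n)$ is a $t$ error correcting code if $d(A,B)\ge 2t+1$ for all distinct $A,B\in\mathcal C$. Let $V(n,t)=\sum_{k=0}^t\binom nk$ and $H(n,t)=2^n/V(n,t)$. Logarithms are base 2. *)

(* Defs.v *)
From HB Require Import structures.
From mathcomp Require Import all_boot all_order all_algebra.
From mathcomp Require Import all_classical all_reals all_analysis.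

Set Implicit Arguments.
Unset Strict Implicit.
Unset Printing Implicit Defensive.

Import Order.TTheory GRing.Theory Num.Theory.
Import numFieldNormedType.Exports.

Definition hamming_dist (n : nat) (A B : {set 'I_n}) : nat :=
  (#|A :\: B| + #|B :\: A|)%N.

Definition is_code (n t : nat) (C : {set {set 'I_n}}) : bool :=
  [forall A in C, forall B in C,
     (A != B) ==> (2 * t + 1 <= hamming_dist A B)%N].

Definition num_codes (n t : nat) : nat :=
  #|[set C : {set {set 'I_n}} | is_code t C]|.

Definition hamming_ball_size (n t : nat) : nat :=
  (\sum_(0 <= k < t.+1) 'C(n, k))%N.

Definition hamming_bound (R : realType) (n t : nat) : R :=
  ((2 ^+ n) / (hamming_ball_size n t)%:R)%R.

Definition log2 (R : realType) (x : R) : R := (ln x / ln 2)%R.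

Definition cuberoot (R : realType) (x : R) : R := (x `^ (3^-1))%R.

(* Main.v *)
(* Codes are the independent sets of the graph joining distinct sets at distance
   at most 2t.  Double counting through balls of radius t shows that every
   family S with |S| > (1 + e) H contains a vertex conflicting with at least a
   fraction beta ~ e n / (2 t (1 + e) H) of S.  Branching on whether that vertex
   lies in the code gives ind(S) <= ind(S - v) + ind(S - N(v)), whose solution is
   ind(S) <= 2^((1 + e) H) (1 + |S| / ((1 + e) H))^a with
   a = 2 ln (1 + n V) / beta.  For S = P(n) the second factor is
   exp (O_e (H t^3 (log n)^2 / n)) = 2^(o(H)). *)
Require Import Defs.
From mathcomp Require Import all_boot all_order all_algebra.
From mathcomp Require Import all_classical all_reals all_analysis.
From mathcomp Require Import zify ring lra.
Import Order.TTheory GRing.Theory Num.Theory.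
Import numFieldNormedType.Exports.

(** * Counting independent sets in a finite graph *)

Section IndependentSets.
Local Open Scope nat_scope.
Context {T : finType} (e : rel T).

Definition independent (I : {set T}) : bool :=
  [forall x in I, forall y in I, ~~ e x y].

Definition num_independent (S : {set T}) : nat :=
  #|[set I : {set T} | (I \subset S) && independent I]|.

Definition degree_in (S : {set T}) (v : T) : nat :=
  #|[set w in S | e v w]|.

Lemma independent_sub {I J : {set T}} :
  I \subset J -> independent J -> independent I.
Proof.
move=> /fintype.subsetP sIJ /forall_inP indJ.
apply/forall_inP => x xI; apply/forall_inP => y yI.
by move/forall_inP: (indJ x (sIJ x xI)) => /(_ y (sIJ y yI)).
Qed.

Lemma num_independent_le_exp (S : {set T}) : num_independent S <= 2 ^ #|S|.
Proof.
rewrite -card_powerset; apply/subset_leq_card/fintype.subsetP => I.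
by rewrite !inE => /andP[].
Qed.

(** Independent sets avoiding [v] give the first term. On those containing [v], deleting [v] is
    injective and leaves a set that misses every neighbour of [v]. *)
Lemma num_independent_step (S : {set T}) (v : T) : v \in S ->
  num_independent S <=
    num_independent (S :\ v) + num_independent ((S :\ v) :\: [set w | e v w]).
Proof.
move=> vS; rewrite /num_independent.
set X := [set I : {set T} | _].
rewrite -(cardsID [set I : {set T} | v \in I] X) addnC leq_add //.
  apply/subset_leq_card/fintype.subsetP => I; rewrite !inE => /and3P[vI sIS ->].
  by rewrite finset.subsetD1 sIS vI.
have inj : {in X :&: [set I : {set T} | v \in I] &,
    injective (fun I : {set T} => I :\ v)}.
  move=> I J; rewrite !inE => /andP[_ vI] /andP[_ vJ] eIJ.
  by rewrite -(finset.setD1K vI) -(finset.setD1K vJ) eIJ.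
rewrite -(card_in_imset inj); apply/subset_leq_card/fintype.subsetP => J /imsetP[I].
rewrite !inE => /andP[/andP[sIS indI] vI] ->.
rewrite (independent_sub (finset.subD1set _ _) indI) andbT.
apply/fintype.subsetP => x; rewrite !inE => /andP[-> xI] /=.
rewrite (fintype.subsetP sIS) // andbT.
by move/forall_inP: indI => /(_ v vI) /forall_inP /(_ x xI).
Qed.

End IndependentSets.

(** * Hamming balls and their pairwise intersections *)

Section HammingBalls.
Local Open Scope nat_scope.
Context {n : nat}.
Implicit Types (A B x y : {set 'I_n}).

(** Addition in the group F_2^n: [symdiff A] is a translation carrying the ball around [A] to the
    ball around the empty set. *)
Definition symdiff A B : {set 'I_n} := (A :\: B) :|: (B :\: A).

Lemma in_symdiff A B i : (i \in symdiff A B) = (i \in A) (+) (i \in B).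
Proof. by rewrite !inE; case: (i \in A); case: (i \in B). Qed.

Lemma card_subsets : #|{set 'I_n}| = 2 ^ n.
Proof. by rewrite -cardsT -powersetT card_powerset cardsT card_ord. Qed.

Lemma symdiffK A : involutive (symdiff A).
Proof. by move=> x; apply/setP => i; rewrite !in_symdiff addKb. Qed.

Lemma hamming_distE A B : hamming_dist A B = #|symdiff A B|.
Proof.
rewrite cardsU (_ : _ :&: _ = finset.set0) ?cards0 ?subn0 //.
by apply/setP => i; rewrite !inE; case: (i \in A); case: (i \in B).
Qed.

Lemma hamming_distC A B : hamming_dist A B = hamming_dist B A.
Proof. exact: addnC. Qed.

Lemma hamming_dist_triangle x A B :
  hamming_dist A B <= hamming_dist A x + hamming_dist x B.
Proof.
rewrite !hamming_distE (leq_trans _ (leq_card_setU _ _)) //.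
apply/subset_leq_card/fintype.subsetP => i; rewrite finset.in_setU !in_symdiff.
by case: (i \in A); case: (i \in B); case: (i \in x).
Qed.

Lemma card_symdiff_preim A (P : pred {set 'I_n}) :
  #|[set x | P (symdiff A x)]| = #|[set y | P y]|.
Proof.
rewrite -(card_imset _ (inv_inj (symdiffK A))); apply: eq_card => y.
rewrite inE; apply/imsetP/idP => [[x + ->]|Py]; first by rewrite inE.
by exists (symdiff A y); rewrite ?inE symdiffK.
Qed.

(** The predicate [P] lets one layering by size serve both a whole ball and its sets through a fixed
    point. *)
Lemma card_small_sets (P : pred {set 'I_n}) t :
  #|[set y : {set 'I_n} | P y && (#|y| <= t)]| =
  \sum_(0 <= k < t.+1) #|[set y : {set 'I_n} | P y && (#|y| == k)]|.
Proof.
elim: t => [|t IH].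
  by rewrite big_nat1; apply: eq_card => y; rewrite !inE leqn0.
rewrite big_nat_recr //= -IH -cardsUI.
rewrite [X in _ + X](_ : _ = 0) ?addn0; last first.
  apply/eqP; rewrite cards_eq0; apply/eqP/setP => y; rewrite !inE.
  by case: (P y) => //=; apply/negbTE; lia.
by apply: eq_card => y; rewrite !inE; case: (P y) => //=; lia.
Qed.

Lemma card_ball A t :
  #|[set x | hamming_dist A x <= t]| = hamming_ball_size n t.
Proof.
have -> : [set x | hamming_dist A x <= t] =
    [set x | (fun y : {set 'I_n} => #|y| <= t) (symdiff A x)].
  by apply/setP => x; rewrite !inE hamming_distE.
rewrite (card_symdiff_preim A (fun y : {set 'I_n} => #|y| <= t)).
rewrite (card_small_sets xpredT); apply: eq_bigr => k _.
by have := card_draws 'I_n k; rewrite card_ord.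
Qed.

(** Among the sets of size [k], a fraction k/n <= t/n contains [i], by n C(n-1, k-1) = k C(n, k). *)
Lemma card_small_sets_through (i : 'I_n) t :
  n * #|[set y : {set 'I_n} | (i \in y) && (#|y| <= t)]|
    <= t * hamming_ball_size n t.
Proof.
rewrite (card_small_sets (fun y : {set 'I_n} => i \in y)) /hamming_ball_size.
rewrite !big_distrr /= !big_mkord.
apply: leq_sum => k _.
have -> : #|[set y : {set 'I_n} | (i \in y) && (#|y| == k)]| =
    'C(n, k) - 'C(n.-1, k).
  have := cardsID [set y : {set 'I_n} | i \in y] [set y : {set 'I_n} | #|y| == k].
  rewrite card_draws card_ord => <-.
  have := cards_draws [set~ i] k; rewrite cardsC1 card_ord => <-.
  rewrite [X in _ + X](_ : _ = #|[set B : {set 'I_n} | (B \subset [set~ i]) & (#|B| == k)]|).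
    by rewrite addnK; apply: eq_card => y; rewrite !inE andbC.
  by apply: eq_card => y; rewrite inE finset.subsetC finset.sub1set !inE.
case: n i => [[]//|m _ /=].
case: k => -[|k] /= lk; first by rewrite !bin0 subnn muln0.
have -> : 'C(m.+1, k.+1) - 'C(m, k.+1) = 'C(m, k) by rewrite binS addKn.
rewrite (mul_bin_diag m.+1 k).
by rewrite leq_mul2r -ltnS lk orbT.
Qed.

(** At a point [i] where [A] and [B] differ, every [x] differs from one of them. Translating by that
    one sends [x] to a small set through [i], and such sets make up at most t/n of a ball; the two
    choices give the factor 2. *)
Lemma card_ball_inter A B t : A != B ->
  n * #|[set x | (hamming_dist A x <= t) && (hamming_dist B x <= t)]|
    <= 2 * t * hamming_ball_size n t.
Proof.
move=> nAB.
have [i iAB] : exists i, i \in symdiff A B.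
  apply/set0Pn; apply: contra nAB => /eqP AB0; apply/eqP/setP => i.
  have := in_symdiff A B i; rewrite AB0 inE.
  by case: (i \in A); case: (i \in B).
pose P (y : {set 'I_n}) := (i \in y) && (#|y| <= t).
have sub : [set x | (hamming_dist A x <= t) && (hamming_dist B x <= t)] \subset
    [set x | P (symdiff A x)] :|: [set x | P (symdiff B x)].
  apply/fintype.subsetP => x; rewrite !inE /P !hamming_distE => /andP[-> ->].
  move: iAB; rewrite !in_symdiff.
  by case: (i \in A); case: (i \in B); case: (i \in x).
have := leq_trans (subset_leq_card sub) (leq_card_setU _ _).
rewrite !card_symdiff_preim => le.
rewrite -mulnA mul2n -addnn.
apply: leq_trans (leq_add (card_small_sets_through i t) (card_small_sets_through i t)).
by rewrite -mulnDr leq_mul2l le orbT.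
Qed.

End HammingBalls.

(** * Supersaturation: large families contain a vertex of high conflict degree *)

Section Supersaturation.
Local Open Scope nat_scope.

(** Sum 2 d(x) d(y) <= d(x)^2 + d(y)^2 over all ordered pairs. *)
Lemma sum_sqr_le {I : finType} (d : I -> nat) :
  (\sum_x d x) ^ 2 <= #|I| * \sum_x d x ^ 2.
Proof.
rewrite -(leq_pmul2l (isT : 0 < 2)) -mulnn big_distrlr /= big_distrr /=.
have -> : 2 * (#|I| * \sum_x d x ^ 2) = \sum_x \sum_y (d x ^ 2 + d y ^ 2).
  under [RHS]eq_bigr do rewrite big_split /= sum_nat_const.
  by rewrite big_split /= sum_nat_const -big_distrr /= mul2n addnn.
apply: leq_sum => x _; rewrite big_distrr; apply: leq_sum => y _.
exact: nat_Cauchy.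
Qed.

Definition conflict (n t : nat) : rel {set 'I_n} :=
  fun A B => (A != B) && (hamming_dist A B <= 2 * t).

Lemma hamming_ball_size_gt0 n t : 0 < hamming_ball_size n t.
Proof. by rewrite /hamming_ball_size big_nat_recl //= bin0. Qed.

(* Count pairs of elements of S lying in a common ball of radius t: by
   Cauchy-Schwarz there are at least (|S| V)^2 / 2^n of them, while a pair of
   distinct sets shares at most 2 t V / n balls, and none unless it conflicts. *)
Lemma conflict_degree (n t : nat) (S : {set {set 'I_n}}) : 0 < #|S| ->
  exists2 v, v \in S &
    n * hamming_ball_size n t * #|S|
      <= 2 ^ n * (n + 2 * t * degree_in (conflict n t) S v).
Proof.
move=> S0; have [v0 v0S] : exists v, v \in S by apply/card_gt0P.
(* A vertex of maximum degree bounds the number of conflicts of every [A] in [S] at once. *)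
case: (@arg_maxnP _ v0 [in S] (degree_in (conflict n t) S) v0S) => v vS vmax.
exists v => //; set V := hamming_ball_size n t; set D := degree_in _ S v.
have V0 : 0 < V by exact: hamming_ball_size_gt0.
(* [d x] counts the members of [S] in the ball around [x]; its second moment counts pairs in a
   common ball. *)
pose d (x : {set 'I_n}) := \sum_(A in S) (hamming_dist A x <= t : nat).
have sumd : \sum_x d x = #|S| * V.
  rewrite exchange_big /= -sum_nat_const; apply: eq_bigr => A _.
  rewrite /V -(card_ball A t) -sum1_card [RHS]big_mkcond /=.
  by apply: eq_bigr => x _; rewrite inE; case: leqP.
have sumd2 : n * \sum_x d x ^ 2 <= #|S| * (V * (n + 2 * t * D)).
  have -> : \sum_x d x ^ 2 = \sum_(A in S) \sum_(B in S)
      #|[set x | (hamming_dist A x <= t) && (hamming_dist B x <= t)]|.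
    under eq_bigr do rewrite -mulnn /d big_distrlr /=.
    rewrite exchange_big /=; apply: eq_bigr => A _.
    rewrite exchange_big /=; apply: eq_bigr => B _.
    rewrite -sum1_card [RHS]big_mkcond /=.
    by apply: eq_bigr => x _; rewrite inE; case: (hamming_dist A x <= t); case: (hamming_dist B x <= t).
  rewrite big_distrr /= -sum_nat_const; apply: leq_sum => A AS.
  (* The diagonal pair shares a full ball, whence the summand [n]; the other pairs give
     [2 * t * D]. *)
  rewrite (bigD1 A) //= mulnDr mulnDr leq_add //.
    rewrite (_ : [set x | _] = [set x | hamming_dist A x <= t]) ?card_ball 1?mulnC //.
    by apply/setP => x; rewrite !inE andbb.
  apply: (@leq_trans (\sum_(B in S | B != A)
      (2 * t * V * (hamming_dist A B <= 2 * t : nat)))).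
    rewrite big_distrr; apply: leq_sum => B /andP[BS nBA] /=.
    case: (leqP (hamming_dist A B)) => [_|far].
      by rewrite muln1 card_ball_inter // eq_sym.
    rewrite muln0 leqn0 muln_eq0 cards_eq0; apply/orP; right.
    apply/eqP/setP => x; rewrite !inE; apply/negbTE/negP => /andP[Ax Bx].
    have := hamming_dist_triangle x A B; rewrite (hamming_distC x B); lia.
  rewrite -big_distrr /= mulnA (mulnC V) leq_mul2l; apply/orP; right.
  apply: leq_trans (vmax A AS).
  rewrite /degree_in -sum1_card big_mkcond /= [X in _ <= X]big_mkcond /=.
  apply: leq_sum => B _; rewrite !inE /conflict eq_sym.
  by case: (B \in S) => //=; case: eqP => //=; case: (hamming_dist A B <= _).
have cauchy := sum_sqr_le d.
rewrite sumd card_subsets in cauchy.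
have mV0 : 0 < #|S| * V by rewrite muln_gt0 S0.
rewrite -(leq_pmul2l mV0).
apply: (@leq_trans (n * (#|S| * V) ^ 2)).
  by rewrite -mulnn; apply: eq_leq; ring.
apply: (leq_trans (leq_mul (leqnn n) cauchy)).
rewrite mulnCA; apply: (leq_trans (leq_mul (leqnn _) sumd2)).
by apply: eq_leq; ring.
Qed.

End Supersaturation.

(** * Solving the branching recursion with a logarithmic potential *)

Local Open Scope classical_set_scope.
Local Open Scope ring_scope.

(** From ln z <= z - 1 at z = x/y: shrinking the argument by a relative amount [c] lowers the
    logarithm by at least [c]. *)
Lemma ln_sub_ge {R : realType} (x y c : R) : 0 < x -> 0 < y ->
  x <= y * (1 - c) -> ln x <= ln y - c.
Proof.
move=> x0 y0 xy; have xy0 : 0 < x / y by rewrite divr_gt0.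
have -> : x = y * (x / y) by field; rewrite gt_eqF.
rewrite lnM ?posrE // lerD2l.
have := le_ln1Dx (x := x / y - 1).
rewrite [1 + _]addrC subrK => /(_ _)/le_trans; apply; first by rewrite ltrBrDr addNr.
by rewrite lerBlDr ler_pdivrMr // mulrC (le_trans xy) // addrC.
Qed.

(* The potential M ln 2 + a ln (1 + |S|/M) drops by at least a/(2|T|) when one
   vertex is deleted and by at least a beta/2 when a beta-fraction of S is. *)
Lemma num_independent_bound {R : realType} {T : finType} (e : rel T)
    (M a beta : R) : 0 < M -> 0 <= a -> 0 <= beta ->
  (forall S : {set T}, M < #|S|%:R ->
    exists2 v, v \in S & beta * #|S|%:R <= (degree_in e S v)%:R) ->
  expR (- (a * (2 * #|T|%:R)^-1)) + expR (- (a * (beta / 2))) <= 1 ->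
  forall S : {set T},
    (num_independent e S)%:R <= expR (M * ln 2 + a * ln (1 + #|S|%:R / M)).
Proof.
move=> M0 a0 beta0 dense step S.
have [k] := ubnP #|S|; elim: k S => // k IH S; rewrite ltnS => Sk.
have arg_gt0 (U : {set T}) : 0 < 1 + #|U|%:R / M.
  by rewrite ltr_pwDl // divr_ge0 // ltW.
(* Below the threshold [M] the trivial bound 2^|S| is already within the first summand of the
   potential. *)
have [SM|MS] := lerP #|S|%:R M.
  apply: (@le_trans _ _ ((2 ^ #|S|)%:R)).
    by rewrite ler_nat num_independent_le_exp.
  rewrite natrX -{1}(lnK (x := 2 : R)) ?posrE // -expRM_natl ler_expR.
  rewrite ler_wpDr //; last by rewrite ler_wpM2r // ln_ge0 // ler1n.
  by rewrite mulr_ge0 // ln_ge0 // lerDl divr_ge0 // ltW.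
have [v vS deg] := dense S MS.
apply: (@le_trans _ _ (num_independent e (S :\ v) +
  num_independent e ((S :\ v) :\: [set w | e v w]%SET))%:R).
  by rewrite ler_nat num_independent_step.
set S1 := S :\ v; set S2 := _ :\: _.
have cS1 : (#|S1|.+1 = #|S|)%N by rewrite (cardsD1 v S) vS.
have cS2 : (#|S2| + degree_in e S v <= #|S|)%N.
  rewrite -(cardsID [set w | e v w]%SET S) addnC leq_add //.
    by apply/subset_leq_card/fintype.subsetP => w; rewrite !inE.
  by apply/subset_leq_card/fintype.subsetP => w; rewrite !inE => /and3P[-> _ ->].
have S2S : (#|S2| <= #|S1|)%N by rewrite subset_leq_card // finset.subsetDl.
rewrite natrD.
apply: (@le_trans _ _ (expR (M * ln 2 + a * ln (1 + #|S|%:R / M)) *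
    (expR (- (a * (2 * #|T|%:R)^-1)) + expR (- (a * (beta / 2)))))); last first.
  by rewrite -[leRHS]mulr1 ler_wpM2l // expR_ge0.
rewrite mulrDr -!expRD; apply: lerD.
  apply: le_trans (IH S1 _) _; first by rewrite cS1.
  rewrite ler_expR -addrA -mulrN -mulrDr lerD2l ler_wpM2l // ln_sub_ge //.
  have ST : (#|S|%:R : R) <= #|T|%:R by rewrite ler_nat max_card.
  have -> : #|S1|%:R = #|S|%:R - 1 :> R by rewrite -cS1 -natr1 addrK.
  have T0 : 0 < (#|T|%:R : R) by lra.
  (* The relative loss is 1/(M + |S|), and M < |S| <= |T|. *)
  have loss : (1 + #|S|%:R / M) * (2 * #|T|%:R)^-1 <= M^-1.
    have -> : 1 + #|S|%:R / M = M^-1 * (M + #|S|%:R).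
      by rewrite mulrDr mulVf ?gt_eqF // mulrC.
    by rewrite ler_pdivrMr ?mulr_gt0 // ler_wpM2l ?invr_ge0; lra.
  by lra.
apply: le_trans (IH S2 _) _; first by rewrite (leq_ltn_trans S2S) // cS1.
rewrite ler_expR -addrA -mulrN -mulrDr lerD2l ler_wpM2l // ln_sub_ge //.
have cS2R : (#|S2|%:R : R) <= #|S|%:R - beta * #|S|%:R.
  by move: cS2; rewrite -(ler_nat R) natrD; lra.
have u0 : 0 < M^-1 by rewrite invr_gt0.
have mu1 : 1 <= #|S|%:R / M by rewrite ler_pdivlMr // mul1r ltW.
(* Since |S|/M >= 1, the added 1 at most doubles |S|/M; this costs the factor 1/2 in [beta / 2]. *)
have gain : beta / 2 * (1 + #|S|%:R / M) <= beta * (#|S|%:R / M) by nra.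
have : #|S2|%:R / M <= (#|S|%:R - beta * #|S|%:R) / M by rewrite ler_wpM2r // ltW.
by lra.
Qed.

(** * The bound on the number of codes for fixed [n] and [t] *)

Lemma num_codesE n t : num_codes n t = num_independent (@conflict n t) [set: _]%SET.
Proof.
apply: eq_card => C; rewrite !inE finset.subsetT /=.
apply: eq_forallb => A; congr (_ ==> _); apply: eq_forallb => B; congr (_ ==> _).
by rewrite /conflict negb_and addn1 -ltnNge; case: eqP.
Qed.

Lemma num_codes_gt0 n t : (0 < num_codes n t)%N.
Proof.
apply/card_gt0P; exists finset.set0; rewrite inE.
by apply/forallP => A; rewrite inE.
Qed.

Lemma hamming_bound_gt0 {R : realType} n t : 0 < hamming_bound R n t.
Proof. by rewrite divr_gt0 ?exprn_gt0 // ltr0n hamming_ball_size_gt0. Qed.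

Lemma ln_num_codes_le {R : realType} (n t : nat) (e : R) :
  (1 < n)%N -> (0 < t)%N -> 0 < e ->
  ln (num_codes n t)%:R <= hamming_bound R n t * ((1 + e) * ln 2 +
    4 * (1 + e) / e * (t%:R / n%:R) * ln (1 + n%:R * (hamming_ball_size n t)%:R) ^+ 2).
Proof.
move=> n1 t0 e0; set H := hamming_bound R n t.
set V : R := (hamming_ball_size n t)%:R; set K := ln (1 + _).
have V1 : 1 <= V by rewrite ler1n hamming_ball_size_gt0.
have V0 : 0 < V by lra.
have n2 : 2 <= n%:R :> R by rewrite ler_nat.
have nR0 : 0 < n%:R :> R by lra.
have t1 : 1 <= t%:R :> R by rewrite ler1n.
have tR0 : 0 < t%:R :> R by lra.
have N0 : 0 < 2 ^+ n :> R by rewrite exprn_gt0.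
have HV : H * V = 2 ^+ n by rewrite /H /hamming_bound -/V mulfVK ?gt_eqF.
have H0 : 0 < H by exact: hamming_bound_gt0.
have nV2 : 2 <= n%:R * V by nra.
have K2 : 1 / 2 <= K.
  have : ln (1 : R) <= K - 1 / 2.
    by apply: ln_sub_ge; lra.
  by rewrite ln1; lra.
(* For |S| > M, supersaturation n|S| <= H(n + 2tD) gives 2tHD >= n(|S| - H) >= n|S| e/(1+e), that is
   D >= b|S|. The choice of [a] then makes the second branching factor exp(-ab/2) equal to exp(-K) =
   1/(1 + nV). *)
pose M := (1 + e) * H; pose b := n%:R * e / (2 * t%:R * M).
pose a := 2 * K / b.
have M0 : 0 < M by rewrite mulr_gt0 //; lra.
have tM0 : 0 < 2 * t%:R * M by apply: mulr_gt0 => //; apply: mulr_gt0.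
have b0 : 0 < b by apply: divr_gt0 => //; apply: mulr_gt0.
have a0 : 0 <= a by rewrite divr_ge0 // ?ltW //; lra.
have dense (S : {set {set 'I_n}}) : M < #|S|%:R ->
    exists2 v, v \in S & b * #|S|%:R <= (degree_in (@conflict n t) S v)%:R.
  move=> MS; have S0 : (0 < #|S|)%N by rewrite -(ltr_nat R); lra.
  have [v vS deg] := @conflict_degree n t S S0.
  exists v => //; move: deg; rewrite -(ler_nat R) !(natrM, natrD, natrX) -HV.
  set D := (degree_in _ _ _)%:R; set m := #|S|%:R in MS *; rewrite -/V => deg.
  have degH : n%:R * m <= H * (n%:R + 2 * t%:R * D).
    by rewrite -(ler_pM2r V0) mulrAC [leRHS]mulrAC.
  rewrite /b mulrAC ler_pdivrMr // /M.
  have : n%:R * ((1 + e) * H) <= n%:R * m by rewrite ler_wpM2l // ltW.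
  have : (1 + e) * (n%:R * m) <= (1 + e) * (H * (n%:R + 2 * t%:R * D)).
    by rewrite ler_wpM2l //; lra.
  lra.
have step : expR (- (a * (2 * #|{set 'I_n}|%:R)^-1)) + expR (- (a * (b / 2))) <= 1.
  rewrite card_subsets natrX -HV.
  have -> : a * (b / 2) = K by rewrite /a; field; rewrite gt_eqF.
  set u := a * _.
  (* With w = nV, the sum 1/(1+u) + 1/(1+w) is at most 1 exactly when uw >= 1. Here uw = 2Kt(1+e)/e,
     and K >= 1/2. *)
  have unV : 1 <= u * (n%:R * V).
    have -> : u * (n%:R * V) = K * (2 * t%:R * ((1 + e) / e)).
      by rewrite /u /a /b /M; field; rewrite !gt_eqF //; lra.
    have ee : 1 <= (1 + e) / e by rewrite ler_pdivlMr //; lra.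
    have tee : 1 <= t%:R * ((1 + e) / e) by nra.
    by rewrite -mulrA; nra.
  have u0 : 0 < u by nra.
  have eu : expR (- u) <= (1 + u)^-1.
    by rewrite expRN lef_pV2 ?posrE ?expR_gt0 ?expR_ge1Dx //; lra.
  have eK : expR (- K) = (1 + n%:R * V)^-1 by rewrite expRN lnK // posrE; lra.
  rewrite eK; apply: le_trans (lerD eu (lexx _)) _.
  have -> : (1 + u)^-1 + (1 + n%:R * V)^-1 =
     (2 + u + n%:R * V) / ((1 + u) * (1 + n%:R * V)).
    by field; rewrite !gt_eqF //; lra.
  by rewrite ler_pdivrMr; [lra | nra].
have := num_independent_bound _ _ _ _ M0 a0 (ltW b0) dense step [set: _]%SET.
rewrite -num_codesE cardsT card_subsets natrX -HV => bound.
have codes0 : 0 < (num_codes n t)%:R :> R by rewrite ltr0n num_codes_gt0.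
apply: (@le_trans _ _ (M * ln 2 + a * ln (1 + H * V / M))).
  by rewrite -ler_expR lnK.
have Q0 : 0 < H * V / M by rewrite divr_gt0 // mulr_gt0.
(* For the whole cube |S|/M = V/(1+e) <= nV, so the potential's logarithm is again at most [K];
   together with the [K] in [a] this produces the square. *)
have lnK_le : ln (1 + H * V / M) <= K.
  rewrite ler_ln ?posrE; [|by lra|by lra].
  rewrite lerD2l ler_pdivrMr // /M.
  have -> : n%:R * V * ((1 + e) * H) = n%:R * (1 + e) * (H * V) by ring.
  by rewrite ler_peMl; [|apply/ltW/mulr_gt0|nra].
apply: le_trans (lerD (lexx _) (ler_wpM2l a0 lnK_le)) _.
rewrite le_eqVlt; apply/orP; left; apply/eqP; rewrite /a /b /M; field; rewrite !gt_eqF //; lra.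
Qed.

(** * Asymptotics: the error term under the cube-root hypothesis *)

Lemma hamming_ball_size_le (n t : nat) : (hamming_ball_size n t <= n.+1 ^ t)%N.
Proof.
rewrite /hamming_ball_size; elim: t => [|t IH]; first by rewrite big_nat1 bin0.
rewrite big_nat_recr //= expnS mulSn leq_add //.
(* C(n, t+1) <= (t+1) C(n, t+1) = (n-t) C(n, t) <= n V(n, t), so each unit of radius costs a factor
   at most n+1. *)
apply: leq_trans (leq_mul (leqnn n) IH).
apply: (@leq_trans (t.+1 * 'C(n, t.+1))); first exact: leq_pmull.
rewrite mul_bin_left leq_mul ?leq_subr // /hamming_ball_size big_nat_recr //=.
exact: leq_addl.
Qed.

Lemma cuberoot_cube {R : realType} (x : R) : 0 <= x -> cuberoot x ^+ 3 = x.
Proof.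
by move=> x0; rewrite -powR_mulrn ?powR_ge0 // -powRrM mulVf // powRr1.
Qed.

Lemma ln_hamming_ball_le {R : realType} (n t : nat) : (1 < n)%N -> (0 < t)%N ->
  ln (1 + n%:R * (hamming_ball_size n t)%:R) <= 4 * (t%:R * log2 n%:R) :> R.
Proof.
move=> n1 t0.
have n2 : 2 <= n%:R :> R by rewrite ler_nat.
have n0 : 0 < n%:R :> R by lra.
have lnn0 : 0 <= ln n%:R :> R by rewrite ln_ge0 //; lra.
have ln2 : 0 < ln 2 :> R by rewrite ln_gt0 // ltr1n.
have ln2_1 : ln 2 <= 1 :> R.
  by have := @le_ln1Dx R 1; rewrite (_ : 1 + 1 = 2) //; apply; lra.
have lnlog : ln n%:R <= log2 n%:R :> R.
  by rewrite /log2 ler_pdivlMr // ler_piMr.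
(* Uses t + 1 <= 2t and n + 1 <= n^2, valid for t >= 1 and n >= 2. *)
have ball : (1 + n * hamming_ball_size n t <= (n ^ 2) ^ (t + t))%N.
  apply: (@leq_trans (n.+1 * hamming_ball_size n t)).
    by rewrite mulSn leq_add2r hamming_ball_size_gt0.
  apply: (@leq_trans (n.+1 ^ t.+1)).
    by rewrite expnS leq_mul2l hamming_ball_size_le.
  apply: (@leq_trans (n.+1 ^ (t + t))).
    by rewrite leq_pexp2l // -addn1 leq_add2l.
  rewrite leq_exp2r; last by rewrite addn_gt0 t0.
  by rewrite -mulnn; nia.
apply: (@le_trans _ _ (ln (((n ^ 2) ^ (t + t))%N%:R : R))).
  rewrite ler_ln ?posrE; first by rewrite -natrM -[1 + _](natrD R 1) ler_nat.
    by rewrite ltr_pwDl // mulr_ge0.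
  by rewrite ltr0n !expn_gt0 (ltnW n1).
rewrite -expnM natrX lnXn // -[ln _ *+ _]mulr_natl natrM natrD.
have t0R : 0 <= t%:R :> R by [].
by nra.
Qed.

Theorem theorem5p1 (R : realType) (t : nat -> nat)
    (t_gt0 : forall n : nat, (0 < t n)%N)
    (t_small :
      (fun n : nat => (t n)%:R / cuberoot (n%:R / (log2 (n%:R : R)) ^+ 2))
        @ \oo --> (0 : R)) :
  exists eps : nat -> R,
    eps @ \oo --> (0 : R) /\
    forall n : nat,
      (num_codes n (t n))%:R
        <= 2 `^ (hamming_bound R n (t n) * (1 + eps n)).
Proof.
have ln2 : 0 < ln 2 :> R by rewrite ln_gt0 // ltr1n.
(* [q n] is the exact relative excess of the exponent, so the inequality holds for every [n];
   truncating at 0 leaves only an upper bound to prove for the limit. *)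
pose q n : R :=
  (hamming_bound R n (t n) * ln 2)^-1 * ln (num_codes n (t n))%:R - 1.
exists (fun n => Num.max 0 (q n)); split; last first.
  move=> n; have H0 := @hamming_bound_gt0 R n (t n).
  have codes0 : 0 < (num_codes n (t n))%:R :> R by rewrite ltr0n num_codes_gt0.
  rewrite -ler_ln ?posrE ?powR_gt0 // ln_powR mulrAC.
  rewrite -ler_pdivrMl; last exact: mulr_gt0.
  by rewrite -lerBlDl le_max lexx orbT.
pose u n : R := (t n)%:R / cuberoot (n%:R / log2 n%:R ^+ 2).
have u3 : (fun n => u n ^+ 3) @ \oo --> (0 : R).
  have := cvgM t_small (cvgM t_small t_small); rewrite !mulr0 => cube0; exact: cube0.
apply/cvgrPdist_le => g g0.
(* Half of [g] pays for the threshold (1+e)H, half for the second summand. [c] solves 64(1+e)/e * c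
   = e ln 2, with 64 = 4 * 16 from the bound on K^2. *)
pose e := g / 2; have e0 : 0 < e by rewrite divr_gt0.
pose c := e * (e * ln 2 / (64 * (1 + e))).
have c0 : 0 < c by rewrite !(mulr_gt0, invr_gt0) //; lra.
move/cvgrPdist_le: u3 => /(_ c c0) u3.
near=> n.
have n1 : (1 < n)%N by near: n; exact: nbhs_infty_gt.
have n0 : 0 < n%:R :> R by rewrite ltr0n ltnW.
have L0 : 0 < log2 n%:R :> R by rewrite divr_gt0 // ln_gt0 // ltr1n.
(* Cubing the hypothesis turns it into t^3 log^2 n / n -> 0, the order of t K^2 / n. *)
have cube : (t n)%:R ^+ 3 * log2 n%:R ^+ 2 / n%:R <= c.
  have : `|0 - u n ^+ 3| <= c.
    by near: n; exact: u3.
  rewrite sub0r normrN => un_le; apply: le_trans (le_trans (ler_norm _) un_le).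
  rewrite /u [(_ / cuberoot _) ^+ 3]expr_div_n cuberoot_cube; last first.
    by rewrite divr_ge0 ?exprn_ge0 // ltW.
  by rewrite invf_div -mulrA.
rewrite sub0r normrN ger0_norm ?le_max ?lexx // ge_max (ltW g0) /=.
have H0 := @hamming_bound_gt0 R n (t n).
rewrite lerBlDl ler_pdivrMl; last exact: mulr_gt0.
apply: le_trans (ln_num_codes_le _ _ _ n1 (t_gt0 n) e0) _.
rewrite -[leRHS]mulrA ler_pM2l //.
set K := ln (1 + _).
have K0 : 0 <= K by rewrite ln_ge0 // lerDl mulr_ge0.
have K2 : K ^+ 2 <= 16 * ((t n)%:R ^+ 2 * log2 n%:R ^+ 2).
  have KL := @ln_hamming_ball_le R n (t n) n1 (t_gt0 n).
  have -> : 16 * ((t n)%:R ^+ 2 * log2 n%:R ^+ 2) =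
    (4 * ((t n)%:R * log2 n%:R)) ^+ 2 :> R by ring.
  have tL0 : 0 <= 4 * ((t n)%:R * log2 n%:R) :> R.
    by apply: mulr_ge0 => //; apply: mulr_ge0 => //; exact: ltW.
  by rewrite lerXn2r // nnegrE.
have tn0 : 0 <= (t n)%:R / n%:R :> R by rewrite divr_ge0.
have e10 : 0 <= 4 * (1 + e) / e by rewrite divr_ge0 ?mulr_ge0 ?ltW //; lra.
have : 4 * (1 + e) / e * ((t n)%:R / n%:R) * K ^+ 2 <= e * ln 2.
  apply: (@le_trans _ _ (64 * (1 + e) / e *
      ((t n)%:R ^+ 3 * log2 n%:R ^+ 2 / n%:R))).
    apply: le_trans (ler_wpM2l (mulr_ge0 e10 tn0) K2) _.
    by rewrite le_eqVlt; apply/orP; left; apply/eqP; field; rewrite !gt_eqF.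
  have e640 : 0 <= 64 * (1 + e) / e by rewrite divr_ge0 ?mulr_ge0 ?ltW //; lra.
  apply: le_trans (ler_wpM2l e640 cube) _.
  rewrite /c le_eqVlt; apply/orP; left; apply/eqP; field.
  by rewrite !gt_eqF //; lra.
have -> : g = e + e by rewrite /e; field.
lra.
Unshelve. all: by end_near.
Qed.
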